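(* For every integer $n\ge 1$, the number of two-ball siteswap sequences $t_1t_2\ldots t_n$ of length $n$ with a non-zero throw made at each time step (i.e. $t_i\ge 1$ for all $i$) is $2^n-1$.
   Context: A siteswap sequence of length (period) $n$ is a sequence $t_1t_2\ldots t_n$ of nonnegative integers such that the residues $i+t_i \pmod n$, $1\le i\le n$, are pairwise distinct, i.e. $\{1,\ldots,n\}=\bigcup_{i=1}^n\{i+t_i \pmod n\}$. Its number of balls is the integer $(t_1+\cdots+t_n)/n$; thus a two-ball siteswap sequence has $t_1+\cdots+t_n=2n$. Rotations of a sequence are considered distinct, and sequences of length $n$ are counted whether or not $n$ is their minimal period. *)

(* Defs.v *)
From mathcomp Require Import all_boot.
From mathcomp Require Import classical_sets cardinality.

Set Implicit Arguments.
Unset Strict Implicit.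
Unset Printing Implicit Defensive.

(* The throws t_1, ..., t_n are stored at the indices 0, ..., n - 1 of the
   tuple, so that the throw made at time [i.+1] is [tnth t i]. *)
Definition siteswap (n : nat) (t : n.-tuple nat) : Prop :=
  injective (fun i : 'I_n => (i.+1 + tnth t i) %% n).

(* The number of balls is the average throw; multiplying out by n avoids the
   truncated division on nat. *)
Definition siteswap_balls (b n : nat) (t : n.-tuple nat) : Prop :=
  siteswap t /\ \sum_(i < n) tnth t i = b * n.

Definition nonzero_throws (n : nat) (t : n.-tuple nat) : Prop :=
  forall i : 'I_n, 1 <= tnth t i.

(* Main.v *)
(** Lowering every throw by one turns these sequences into the one-ball siteswap
    sequences [s] of length [n], and [s] is determined by its nonempty support
    [S].  Indeed [i |-> i + s_i mod n] is injective and fixes every point outside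
    [S], so it maps [S] to [S]; hence for [i] in [S] the throw [s_i] is at least
    the cyclic distance from [i] to the next point of [S].  These distances add
    up to [n], as do the [s_i], so all the inequalities are equalities. *)

Require Import Defs.
From mathcomp Require Import all_boot.
From mathcomp Require Import classical_sets cardinality.
From mathcomp Require Import zify.

Set Implicit Arguments.

(** Positions range over all of [nat] and are read modulo [n], so that cyclic distances need no
    wrap-around. *)
Definition hits {n} (S : {set 'I_n}) (k : nat) : bool :=
  [exists i in S, i == k %% n :> nat].

(* The first [m > 0] with [hits S (k + m)]; it is [n.+1] if [S] is empty. *)
Definition gap {n} (S : {set 'I_n}) (k : nat) : nat :=
  (find (fun m => hits S (k + m.+1)) (iota 0 n)).+1.

Lemma hits_ord {n} (S : {set 'I_n}) (i : 'I_n) : hits S i = (i \in S).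
Proof.
apply/existsP/idP => [[j /andP[jS /eqP]]|iS].
  by rewrite modn_small // => /val_inj <-.
by exists i; rewrite iS modn_small //=.
Qed.

Lemma eq_hits {n} (S : {set 'I_n}) (k l : nat) :
  k = l %[mod n] -> hits S k = hits S l.
Proof. by rewrite /hits => ->. Qed.

Lemma gap_le {n} (S : {set 'I_n}) (k m : nat) :
  0 < m -> hits S (k + m) -> gap S k <= m.
Proof.
case: m => // m _ hm; rewrite ltnS.
(* For [n <= m] the bound is free, as [find] never exceeds the list length [n]. *)
have [lt_mn|le_nm] := ltnP m n; last first.
  by apply: leq_trans le_nm; rewrite -[leqRHS](size_iota 0) find_size.
rewrite leqNgt; apply/negP => /(before_find 0).
by rewrite nth_iota // add0n hm.
Qed.

Lemma hits_gap {n} (S : {set 'I_n}) (x : 'I_n) (k : nat) :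
  x \in S -> hits S (k + gap S k).
Proof.
move=> xS; have n_gt0 : 0 < n by apply: leq_ltn_trans (ltn_ord x).
set a := fun m => hits S (k + m.+1).
have ha : has a (iota 0 n).
  (* The witness is the residue of [x - k.+1], so that [k + m.+1] is congruent to [x]. *)
  apply/hasP; exists ((x + (n - k.+1 %% n)) %% n).
    by rewrite mem_iota ltn_mod.
  rewrite /a (@eq_hits _ _ _ x) ?hits_ord // addnS -addSn modnDmr -modnDml.
  by rewrite addnCA subnKC ?modnDr // ltnW // ltn_mod.
have := nth_find 0 ha; rewrite nth_iota ?add0n //.
by rewrite -[ltnRHS](size_iota 0) -has_find.
Qed.

Lemma eq_gap {n} (S : {set 'I_n}) (k l : nat) :
  k = l %[mod n] -> gap S k = gap S l.
Proof.
move=> kl; congr _.+1; apply: eq_find => m; apply: eq_hits.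
by rewrite -modnDml kl modnDml.
Qed.

(** Either the next point of [S] after [k] is [k.+1] itself, or it is also the next one after
    [k.+1], which is one step closer. *)
Lemma gapS {n} (S : {set 'I_n}) (x : 'I_n) (k : nat) : x \in S ->
  gap S k = (~~ hits S k.+1 * gap S k.+1).+1.
Proof.
move=> xS; case h: (hits S k.+1) => /=.
  by apply/eqP; rewrite mul0n eqn_leq gap_le ?addn1.
rewrite mul1n; apply/eqP; rewrite eqn_leq; apply/andP; split.
  by apply: gap_le => //; rewrite addnS -addSn (hits_gap _ xS).
have := hits_gap k xS; have : 0 < gap S k by [].
case: (gap S k) => // -[|m] _; first by rewrite addn1 h.
by rewrite ltnS addnS -addSn; apply: gap_le.
Qed.

(* Sum [gapS] over one period: the left side and the shifted sum of all gaps
   cancel except at the points of [S]. *)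
Lemma sum_gap {n} (S : {set 'I_n}) (x : 'I_n) : x \in S ->
  \sum_(i < n) (i \in S) * gap S i = n.
Proof.
move=> xS; have shift (F : nat -> nat) : F n = F 0 ->
    \sum_(i < n) F i.+1 = \sum_(i < n) F i.
  move=> Fn; apply/eqP; rewrite -(eqn_add2l (F 0)) -(big_ord_recl n F).
  by rewrite big_ord_recr /= Fn addnC.
have e0 : \sum_(i < n) gap S i = n + \sum_(i < n) ~~ (i \in S) * gap S i.
  transitivity (\sum_(i < n) (1 + ~~ hits S i.+1 * gap S i.+1)).
    by apply: eq_bigr => i _; rewrite (gapS _ xS).
  rewrite big_split /= sum1_card card_ord; congr (_ + _).
  rewrite (shift (fun k => ~~ hits S k * gap S k)).
    by apply: eq_bigr => i _; rewrite hits_ord.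
  by rewrite (@eq_hits _ S n 0) ?(@eq_gap _ S n 0) // modnn mod0n.
apply/eqP; rewrite -(eqn_add2r (\sum_(i < n) ~~ (i \in S) * gap S i)) -e0.
rewrite -big_split /=; apply/eqP/eq_bigr => i _.
by case: (i \in S); rewrite ?mul0n ?mul1n ?addn0.
Qed.

(** The successor undoes the lowering of the throws by one. *)
Definition support_tuple {n} (S : {set 'I_n}) : n.-tuple nat :=
  [tuple ((i \in S) * gap S i).+1 | i < n].

Definition support {n} (t : n.-tuple nat) : {set 'I_n} :=
  [set i | 1 < tnth t i]%SET.

Lemma support_tupleK {n} : cancel (@support_tuple n) support.
Proof.
by move=> S; apply/setP => i; rewrite inE tnth_mktuple; case: (i \in S).
Qed.

(** The two landing positions differ by the constant 2, and translation modulo [n] preserves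
    injectivity. *)
Lemma siteswap_pred {n} (t : n.-tuple nat) : nonzero_throws t ->
  siteswap t <-> injective (fun i : 'I_n => (i + (tnth t i).-1) %% n).
Proof.
move=> t_gt0.
have e (i : 'I_n) : i.+1 + tnth t i = 2 + (i + (tnth t i).-1).
  by have := t_gt0 i; lia.
split=> inj i j /= /eqP ij; apply: inj; apply/eqP; move: ij => /=.
  by rewrite !e eqn_modDl.
by rewrite !e eqn_modDl.
Qed.

Lemma support_tuple_siteswap {n} (S : {set 'I_n}) (x : 'I_n) :
  x \in S -> siteswap (support_tuple S).
Proof.
move=> xS; apply/siteswap_pred => [i|i j /=]; first by rewrite tnth_mktuple.
rewrite !tnth_mktuple /= => ij.
(* A landing position lies in [S] exactly when its start does, so a collision cannot mix a point of
   [S] with one outside. *)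
have iS (k : 'I_n) : hits S (k + (k \in S) * gap S k) = (k \in S).
  case kS: (k \in S); first by rewrite mul1n (hits_gap _ xS).
  by rewrite mul0n addn0 hits_ord.
have eS : (i \in S) = (j \in S) by rewrite -(iS i) -(iS j); apply: eq_hits.
move: ij; rewrite -eS; case hi: (i \in S); last first.
  by rewrite !mul0n !addn0 !modn_small // => /val_inj.
have hj : j \in S by rewrite -eS.
rewrite !mul1n; move: hi hj; clear eS.
wlog le_ji : i j / gap S j <= gap S i.
  by move=> H iiS jS ij; case: (leqP (gap S j) (gap S i)) => [/H|/ltnW/H] ->.
(* Cancelling [gap S j] puts [j] at distance [gap S i - gap S j] after [i]; if positive, this is
   shorter than [gap S i], against minimality. *)
move=> iiS jS; rewrite -(subnK le_ji) addnA => /eqP; rewrite eqn_modDr => /eqP ij.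
have [d0|d_gt0] := posnP (gap S i - gap S j).
  by apply: val_inj; move: ij; rewrite d0 addn0 !modn_small.
have := @gap_le _ S i _ d_gt0; rewrite (eq_hits _ _ _ ij) hits_ord jS => /(_ isT).
by rewrite leqNgt ltn_subrL.
Qed.

Lemma siteswap_support_tuple {n} (t : n.-tuple nat) :
  0 < n -> siteswap_balls 2 t -> nonzero_throws t ->
  (exists y, y \in support t) /\ t = support_tuple (support t).
Proof.
move=> n_gt0 [t_inj t_sum] t_gt0.
set S := support t; set s := fun i => (tnth t i).-1.
have s_inj : injective (fun i : 'I_n => (i + s i) %% n) by apply/siteswap_pred.
have s_sum : \sum_(i < n) s i = n.
  have : \sum_(i < n) (s i + 1) = 2 * n.
    by rewrite -t_sum; apply: eq_bigr => i _; rewrite addn1 prednK ?t_gt0.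
  by rewrite big_split /= sum1_card card_ord; lia.
have sS (i : 'I_n) : (i \in S) = (0 < s i).
  by rewrite inE /s; case: (tnth t i).
(* With empty support all [s i] vanish, while their sum [n] is positive. *)
have S_neq0 : exists y, y \in S.
  apply/existsP; apply: contraTT n_gt0 => /existsPn S0.
  rewrite -[in ltnRHS]s_sum big1 // => i _.
  by apply/eqP; rewrite -leqn0 leqNgt -sS.
have [y yS] := S_neq0; split=> //.
have gap_le_s (i : 'I_n) : true ->
    (i \in S) * gap S i <= s i ?= iff ((i \in S) * gap S i == s i).
  move=> _; split=> //; case iS: (i \in S) => //; rewrite mul1n.
  apply: gap_le; first by rewrite -sS.
  have lt_j : (i + s i) %% n < n by rewrite ltn_mod.
  rewrite (@eq_hits _ _ _ (Ordinal lt_j)) ?modn_mod // hits_ord.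
  (* A landing point outside [S] would be fixed, hence equal to [i] by injectivity, although [i] is
     in [S]. *)
  apply/negPn/negP => jS; move: (jS); rewrite sS -eqn0Ngt => /eqP sj0.
  have /s_inj ji : (Ordinal lt_j + s (Ordinal lt_j)) %% n = (i + s i) %% n.
    by rewrite sj0 addn0 modn_mod.
  by move: jS; rewrite ji iS.
have [_] := leqif_sum gap_le_s; rewrite (sum_gap yS) s_sum eqxx.
move=> /esym/forallP eq_s.
apply: eq_from_tnth => i; rewrite tnth_mktuple (eqP (eq_s i)).
by rewrite prednK ?t_gt0.
Qed.

Unset Implicit Arguments.

Local Open Scope classical_set_scope.
Local Open Scope card_scope.

(** [enum_val] is a bijection from the ordinals below [#|A|] onto [A]. *)
Lemma finset_card_eq {T : finType} (A : {set T}) : [set` A] #= `I_#|A|.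
Proof.
have -> : [set` A] = [set enum_val i | i in [set: 'I_#|A|]].
  apply/seteqP; split=> [x /= xA|_ /= [i _ <-]]; last exact: enum_valP.
  by exists (enum_rank_in xA x); rewrite // enum_rankK_in.
apply: card_eq_trans (card_esym card_II).
by apply: inj_card_eq => i j _ _; apply: enum_val_inj.
Qed.

Theorem mainTheorem4 (n : nat) (hn : 1 <= n) :
  [set t : n.-tuple nat | siteswap_balls 2 t /\ nonzero_throws t]
    #= `I_(2 ^ n - 1).
Proof.
(* The number is that of the nonempty supports. *)
have -> : 2 ^ n - 1 = #|[set~ finset.set0 : {set 'I_n}]%SET|.
  by rewrite cardsC1 -cardsT -powersetT card_powerset cardsT card_ord subn1.
apply: card_eq_trans (finset_card_eq _).
set A := [set~ finset.set0 : {set 'I_n}]%SET.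
have -> : [set t : n.-tuple nat | siteswap_balls 2 t /\ nonzero_throws t]
          = [set support_tuple S | S in [set` A]].
  apply/seteqP; split=> [t /= [t_balls t_gt0]|_ /= [S SA <-]].
    have [[y yS] e] := siteswap_support_tuple hn t_balls t_gt0.
    by exists (support t) => //=; rewrite !inE; apply/set0Pn; exists y.
  have [x xS] : exists x, x \in S by apply/set0Pn; move: SA; rewrite !inE.
  split; last by move=> i; rewrite tnth_mktuple.
  split; first exact: support_tuple_siteswap xS.
  (* The gaps contribute [n] and the added ones another [n]. *)
  under eq_bigr => i _ do rewrite tnth_mktuple -addn1.
  by rewrite big_split /= (sum_gap xS) sum1_card card_ord mul2n addnn.
by apply: inj_card_eq => S T _ _; apply: (can_inj support_tupleK).
Qed.
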